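(* Let $p\ge 1$, $J=\{1,\dots,p\}$, $C=[0,1]^p$. Let $\{T_H^*: H\subset J\}$ be a family, indexed by all $2^p$ subsets of $J$, of independent processes such that each $T_H^*$ is a Brownian $H$-tent, and let $R_H^*(t)=\Big(\prod_{j\in J\setminus H}t_j\Big)\,T_H^*(t_H)$, $t\in C$, be the corresponding Brownian $H$-ramps. Then the sum $W^*=\sum_{H\subset J}R_H^*$ is a $p$-Brownian sheet on $C$.
   Context: For $H\subset J$ (including $H=\emptyset$ and $H=J$) and $t=(t_1,\dots,t_p)\in C$, $t_H$ denotes the point of $C$ with $(t_H)_j=t_j$ if $j\in H$ and $(t_H)_j=1$ if $j\notin H$; $C_H=\{t_H: t\in C\}$ (so $C_\emptyset=\{(1,\dots,1)\}$ and $C_J=C$). A Brownian $H$-tent is a centred Gaussian process $T_H$ on $C_H$ with covariances $\mathbf{E}\,T_H(s)T_H(t)=\prod_{j\in H}(s_j\wedge t_j-s_jt_j)$ for $s,t\in C_H$ (empty products equal $1$). The associated Brownian $H$-ramp is the process on $C$ given by $R_H(t)=\big(\prod_{j\in J\setminus H}t_j\big)T_H(t_H)$. A $p$-Brownian sheet on $C$ is a centred Gaussian process $\{W(t):t\in C\}$ with covariances $\mathbf{E}\,W(s)W(t)=\prod_{j=1}^p (s_j\wedge t_j)$. *)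

(* Defs.v *)
From HB Require Import structures.
From mathcomp Require Import all_boot all_order all_algebra.
From mathcomp Require Import all_classical all_reals all_analysis.
From mathcomp Require Import measurable_realfun.

Set Implicit Arguments.
Unset Strict Implicit.
Unset Printing Implicit Defensive.

Import Order.TTheory GRing.Theory Num.Theory.

Local Open Scope classical_set_scope.
Local Open Scope ring_scope.

Section Gaussian.
Context d (Om : measurableType d) (R : realType) (P : probability Om R).

(* N(m, s^2). [normal_prob m 0] is by convention the uniform law on [0, 1]; in a Gaussian
   process the degenerate normal law N(m, 0) has to be the Dirac mass at m. *)
Definition gaussian_law (m s : R) : set R -> \bar R :=
  if s == 0 then \d_m else normal_prob m s.

Definition gaussian (X : {RV P >-> R}) : Prop :=
  exists m s : R, forall B : set R, measurable B ->
    distribution P X B = gaussian_law m s B.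

Definition gaussian_process (I : Type) (X : I -> {RV P >-> R}) : Prop :=
  forall (n : nat) (t : 'I_n -> I) (a : 'I_n -> R),
    gaussian (\sum_(i < n) a i *: X (t i)).

Definition centred_process (I : Type) (X : I -> {RV P >-> R}) : Prop :=
  forall t : I, ('E_P[X t] = 0)%E.

Definition process_sigma_algebra (I : Type) (X : I -> {RV P >-> R}) :
    set (set Om) :=
  <<s \bigcup_(t in [set: I]) g_sigma_algebra_preimage (X t) >>.

Definition independent_processes (K : finType) (I : K -> Type)
    (X : forall k : K, I k -> {RV P >-> R}) : Prop :=
  forall (L : {set K}) (A : K -> set Om),
    (forall k, k \in L -> process_sigma_algebra (X k) (A k)) ->
    P (\bigcap_(k in [set` L]) A k) = (\prod_(k in L) P (A k))%E.

End Gaussian.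

Arguments gaussian {d Om R} P X.
Arguments gaussian_process {d Om R} P {I} X.
Arguments centred_process {d Om R} P {I} X.
Arguments process_sigma_algebra {d Om R} P {I} X.
Arguments independent_processes {d Om R} P {K I} X.

Section Cube.
Context (R : realType) (p : nat).
Implicit Types (H : {set 'I_p}) (t : 'rV[R]_p).

Definition cube : set 'rV[R]_p := [set t | forall j, 0 <= t 0 j <= 1].

Definition cube_proj H t : 'rV[R]_p :=
  \row_j (if j \in H then t 0 j else 1).

Definition face H : set 'rV[R]_p := cube_proj H @` cube.

Definition to_face H (t : cube) : face H :=
  SigSub (mem_set (imageP (cube_proj H) (set_valP t))).

End Cube.

Arguments cube R p : clear implicits.
Arguments face R {p} H.

Section Brownian.
Context d (Om : measurableType d) (R : realType) (P : probability Om R).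
Context (p : nat).

Definition brownian_tent (H : {set 'I_p}) (T : face R H -> {RV P >-> R}) :
    Prop :=
  [/\ gaussian_process P T, centred_process P T &
    forall s t : face R H, 'E_P[T s \* T t]%E =
      (\prod_(j in H) (Num.min (\val s 0 j) (\val t 0 j)
                       - \val s 0 j * \val t 0 j))%:E].

Definition ramp (H : {set 'I_p}) (T : face R H -> {RV P >-> R})
    (t : cube R p) : {RV P >-> R} :=
  (\prod_(j in ~: H) \val t 0 j) *: T (to_face H t).

Definition brownian_sheet (W : cube R p -> {RV P >-> R}) : Prop :=
  [/\ gaussian_process P W, centred_process P W &
    forall s t : cube R p, 'E_P[W s \* W t]%E =
      (\prod_(j < p) Num.min (\val s 0 j) (\val t 0 j))%:E].

End Brownian.

Arguments brownian_tent {d Om R} P {p H} T.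
Arguments brownian_sheet {d Om R} P {p} W.

(* Main.v *)
From HB Require Import structures.
Require Import Defs.
From mathcomp Require Import all_boot all_order all_algebra.
From mathcomp Require Import all_classical all_reals all_analysis.
From mathcomp Require Import measurable_realfun ring.

Import Order.TTheory GRing.Theory Num.Theory.

Local Open Scope classical_set_scope.
Local Open Scope ring_scope.

(** The sum of the ramps has the covariance of a Brownian sheet because of the
identity
  prod_j min(s_j, t_j) = prod_j ((min(s_j, t_j) - s_j t_j) + s_j t_j),
whose right-hand side expands, over the subsets H of J, into the sum of
  prod_(j notin H) s_j t_j * prod_(j in H) (min(s_j, t_j) - s_j t_j)
([prod_min_split]); the H-th summand is the covariance of the H-th ramp. The
cross terms vanish: tents are square integrable, centred and independent, and
the expectation of a product of independent variables is the product of their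
expectations ([expectation_mul]).

The sum is a Gaussian process because a linear combination of its values is a
sum over H of linear combinations of values of the H-th tent. Each of these is
normal, they are independent, and a finite sum of independent normal variables
is normal ([gaussian_sum]). This rests on two facts. The law of a pair of
independent variables is the product of their laws ([joint_law]). The
convolution of N(m1, s1^2) and N(m2, s2^2) is N(m1 + m2, s1^2 + s2^2)
([gaussian_law_conv]); for nonzero s1 and s2 this follows by completing the
square ([normal_pdf_conv]): as a function of the first summand x, the product
of the two densities is the density of the sum times a normal density, and the
latter integrates to 1.

Independence of several variables is carried through the induction on the
number of summands by keeping an extra event E in the statements: P(X in A, E)
is shown to be the product of P(X in A) and P(E), where E is determined by the
variables that have not been summed yet. *)

(** * Translations of the line *)

Section translation.
Context {R : realType}.
Implicit Types a m s x z : R.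
Local Notation mu := (@lebesgue_measure R).

Lemma measurable_addl a : measurable_fun [set: measurableTypeR R]
  (fun x : measurableTypeR R => a + x : measurableTypeR R).
Proof. exact: measurable_funD. Qed.

Lemma lebesgue_measure_addl a (A : set R) : measurable A ->
  mu ((fun x => a + x) @^-1` A) = mu A.
Proof.
move=> mA.
pose f : measurableTypeR R -> measurableTypeR R := fun x => a + x.
have mf : measurable_fun setT f by exact: measurable_addl.
pose fm : {mfun _ >-> _} := HB.pack f (isMeasurableFun.Build _ _ _ _ _ mf).
rewrite -[LHS]/(pushforward mu fm A); apply/esym.
apply: lebesgue_measure_unique => //= _ [[b c]] _ <-.
rewrite /pushforward/=.
have -> : f @^-1` `]b, c] = `]b - a, c - a]%classic.
  by apply/seteqP; split => x /=; rewrite /f !in_itv/= ltrBlDl lerBrDl.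
rewrite !lebesgue_measure_itv/= !lte_fin ltrD2r -!EFinB.
by rewrite opprD opprK addrACA addNr addr0.
Qed.

Lemma ge0_integral_addl a (A : set R) (f : R -> \bar R) : measurable A ->
  measurable_fun A f -> (forall x, (0 <= f x)%E) ->
  (\int[mu]_(x in (fun x => a + x)%R @^-1` A) f (a + x)%R =
   \int[mu]_(x in A) f x)%E.
Proof.
move=> mA mf f0.
pose f' : measurableTypeR R -> measurableTypeR R := fun x => a + x.
have mf' : measurable_fun setT f' by exact: measurable_addl.
pose g : {mfun _ >-> _} := HB.pack f' (isMeasurableFun.Build _ _ _ _ _ mf').
rewrite -(@ge0_integral_pushforward _ _ (measurableTypeR R) (measurableTypeR R)
  R g mf' mu A f mA mf (fun _ _ => f0 _)).
by apply: eq_measure_integral => //= B mB _;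
  rewrite /pushforward lebesgue_measure_addl.
Qed.

Lemma measurable_preimage_add (B : set R) : measurable B ->
  measurable ((fun z : measurableTypeR R * measurableTypeR R =>
    z.1 + z.2) @^-1` B).
Proof.
move=> mB; rewrite -[X in measurable X]setTI.
have : measurable_fun setT (fun z : measurableTypeR R * measurableTypeR R =>
  z.1 + z.2) by exact: measurable_funD.
exact.
Qed.

End translation.

(** * Normal laws *)

Section normal_laws.
Context {R : realType}.
Implicit Types a m s x z : R.
Local Notation mu := (@lebesgue_measure R).

Lemma normal_pdf_addl a m s x : s != 0 ->
  normal_pdf (a + m) s (a + x) = normal_pdf m s x.
Proof.
by move=> s0; rewrite !normal_pdfE// /normal_fun opprD addrACA subrr add0r.
Qed.

Lemma normal_prob_addl a m s (A : set R) : s != 0 -> measurable A ->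
  normal_prob m s ((fun x => a + x) @^-1` A) = normal_prob (a + m) s A.
Proof.
move=> s0 mA; rewrite /normal_prob.
under eq_integral do rewrite -(normal_pdf_addl a m)//.
rewrite (@ge0_integral_addl R a A (fun x => (normal_pdf (a + m) s x)%:E))//.
- apply/measurable_EFinP; apply: measurable_funTS; exact: measurable_normal_pdf.
- by move=> x; rewrite lee_fin normal_pdf_ge0.
Qed.

(** [normal_pdf m s] is the density of [normal_prob m s]. *)
Lemma integral_normal_prob m s (f : R -> \bar R) : measurable_fun setT f ->
  (\int[normal_prob m s]_x `|f x| < +oo)%E ->
  (\int[normal_prob m s]_x f x = \int[mu]_x (f x * (normal_pdf m s x)%:E))%E.
Proof.
move=> mf finf.
rewrite -(Radon_Nikodym_change_of_variables (normal_prob_dominates m s))//=;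
  last first.
  by apply/integrableP; split.
apply: ae_eq_integral => //.
- apply: emeasurable_funM => //; apply: (measurable_int mu).
  by apply: Radon_Nikodym_integrable; exact: normal_prob_dominates.
- apply: emeasurable_funM => //=; apply/measurableT_comp => //=.
  exact: measurable_normal_pdf.
- apply: ae_eqe_mul2l => /=.
  rewrite Radon_NikodymE//=; first exact: normal_prob_dominates.
  move=> dom.
  (* two densities of the same law agree almost everywhere *)
  case: cid => /= h [h1 h2 h3].
  apply: integral_ae_eq => //=.
  + by apply/measurableT_comp => //; exact: measurable_normal_pdf.
  + by move=> E _ mE; rewrite -h3.
Qed.

(** Completing the square: for fixed z, the joint density of the first summand
and of the sum is, as a function of the first summand x, a constant multiple of
a normal density; the constant is the density of the sum at z. *)
Lemma normal_pdf_conv m1 m2 s1 s2 x z : s1 != 0 -> s2 != 0 ->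
  let v := s1 ^+ 2 + s2 ^+ 2 in
  normal_pdf (m2 + x) s2 z * normal_pdf m1 s1 x =
  normal_pdf (m1 + m2) (Num.sqrt v) z *
  normal_pdf ((m1 * s2 ^+ 2 + (z - m2) * s1 ^+ 2) / v) (s1 * s2 / Num.sqrt v) x.
Proof.
move=> s10 s20 v.
have v0 : 0 < v.
  by apply: addr_gt0; rewrite exprn_even_gt0.
have sv0 : 0 < Num.sqrt v by rewrite sqrtr_gt0.
have svE : Num.sqrt v ^+ 2 = v by rewrite sqr_sqrtr// ltW.
have s30 : s1 * s2 / Num.sqrt v != 0.
  by rewrite !mulf_neq0// invr_eq0 gt_eqF.
rewrite !normal_pdfE// ?gt_eqF// /normal_fun.
rewrite mulrACA [RHS]mulrACA -!expRD.
congr (_ * _); last congr expR.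
  have c0 s : 0 <= s ^+ 2 * pi *+ 2.
    by rewrite mulrn_wge0// mulr_ge0 ?sqr_ge0 ?pi_ge0.
  rewrite /normal_peak -!invfM -!sqrtrM//.
  congr (Num.sqrt _)^-1; rewrite !expr_div_n !exprMn svE.
  suff H (w q a b : R) : w != 0 ->
      b * q *+ 2 * (a * q *+ 2) = w * q *+ 2 * (a * b / w * q *+ 2).
    by apply: H; rewrite gt_eqF.
  by move=> w0; field.
have : v != 0 by rewrite gt_eqF.
rewrite !expr_div_n !exprMn svE /v.
move=> vn0; clear -s10 s20 vn0.
field.
by rewrite vn0 s20 s10.
Qed.

(** Only the square of the parameter s matters, also when s = 0. *)
Lemma gaussian_law_norm m s : gaussian_law m `|s| = gaussian_law m s.
Proof.
have [->|s0] := eqVneq s 0; first by rewrite normr0.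
rewrite /gaussian_law normr_eq0 (negPf s0); apply/funext => A.
rewrite /normal_prob; congr integral; apply/funext => x; congr EFin.
rewrite !normal_pdfE ?normr_eq0// /normal_peak /normal_fun.
by rewrite !real_normK// num_real.
Qed.

Lemma gaussian_law_addl a m s (A : set R) : measurable A ->
  gaussian_law m s ((fun x => a + x) @^-1` A) = gaussian_law (a + m) s A.
Proof.
move=> mA; have [->|s0] := eqVneq s 0; last first.
  by rewrite /gaussian_law (negPf s0) normal_prob_addl.
rewrite /gaussian_law eqxx.
by rewrite !diracE; congr ((_ : bool)%:R%:E); rewrite !inE.
Qed.

(** The convolution of two normal laws is normal. Both laws may be degenerate: a
Dirac mass acts as a translation. *)
Lemma gaussian_law_conv m1 s1 m2 s2 (P Q : probability (measurableTypeR R) R)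
    (hP : forall B : set R, measurable B -> P B = gaussian_law m1 s1 B)
    (hQ : forall B : set R, measurable B -> Q B = gaussian_law m2 s2 B)
    (B : set R) : measurable B ->
  (\int[P]_x Q ((fun y => x + y)%R @^-1` B) =
   gaussian_law (m1 + m2)%R (Num.sqrt (s1 ^+ 2 + s2 ^+ 2)%R) B)%E.
Proof.
move=> mB.
have mD := @measurable_preimage_add R _ mB.
have mshift x : measurable ((fun y : R => x + y) @^-1` B).
  by rewrite -[X in measurable X]setTI; exact: measurable_addl.
have mQ : measurable_fun setT
    (fun x : measurableTypeR R => Q ((fun y => x + y) @^-1` B)).
  apply: eq_measurable_fun (measurable_fun_xsection Q mD) => x _ /=.
  by rewrite /xsection/=; congr (Q _); apply/seteqP; split => y /=; rewrite inE.
have Qlt : (\int[P]_x `|Q ((fun y => x + y)%R @^-1` B)| < +oo)%E.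
  apply: (@le_lt_trans _ _ (\int[P]_x 1)%E); last first.
    rewrite integral_cst// mul1e.
    exact: le_lt_trans (probability_le1 P measurableT) (ltry _).
  apply: ge0_le_integral => //=; first exact: measurableT_comp.
  by move=> x _; rewrite gee0_abs//; exact: (probability_le1 Q (mshift _)).
have [s10|s10] := eqVneq s1 0.
  rewrite (eq_measure_integral (dirac (m1 : measurableTypeR R))); last first.
    by move=> A mA _; apply: etrans (hP A mA) _; rewrite /gaussian_law s10 eqxx.
  rewrite integral_dirac// diracT mul1e (hQ _ (mshift _)).
  rewrite (gaussian_law_addl _ _ _ _ mB) s10 expr0n/= add0r sqrtr_sqr.
  by rewrite gaussian_law_norm.
have [s20|s20] := eqVneq s2 0.
  transitivity (\int[P]_x (\1_((fun x => m2 + x)%R @^-1` B) x)%:E)%E.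
    apply: eq_integral => x _.
    rewrite (hQ _ (mshift _)) /gaussian_law s20 eqxx diracE indicE.
    congr ((_ : bool)%:R%:E).
    by apply/idP/idP => /set_mem h; apply/mem_set; move: h; rewrite /= addrC.
  rewrite integral_indic; [|exact: measurableT|exact: mshift]; rewrite setIT.
  apply: etrans (hP _ (mshift _)) _; rewrite (gaussian_law_addl _ _ _ _ mB).
  by rewrite s20 expr0n/= addr0 sqrtr_sqr gaussian_law_norm addrC.
have NE A : measurable A -> A `<=` setT -> normal_prob m1 s1 A = P A.
  move=> mA _; apply/esym; apply: etrans (hP A mA) _.
  by rewrite /gaussian_law (negPf s10).
rewrite (eq_measure_integral (normal_prob m1 s1))//; last first.
  by move=> A mA sA; apply/esym/NE.
rewrite integral_normal_prob//; last first.
  rewrite (eq_measure_integral P); first exact: Qlt.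
  by move=> A mA sA; apply: NE.
(* joint density of the first summand and of the sum, restricted to sums in B *)
pose F (xz : measurableTypeR R * measurableTypeR R) : R :=
  \1_B xz.2 * (normal_pdf (m2 + xz.1) s2 xz.2 * normal_pdf m1 s1 xz.1).
have F0 xz : 0 <= F xz by rewrite /F !mulr_ge0// normal_pdf_ge0.
have mF : measurable_fun setT F.
  apply: measurable_funM.
    by apply: measurableT_comp => //; exact: measurable_indic.
  apply: measurable_funM; last first.
    by apply: measurableT_comp => //; exact: measurable_normal_pdf.
  under eq_fun do rewrite normal_pdfE//.
  apply: measurable_funM => //; apply: measurableT_comp => //.
  apply: measurable_funM => //; apply: measurableT_comp => //.
  apply: measurable_funX => //; apply: measurable_funB => //.
  exact: measurable_funD.
transitivity (\int[mu]_x \int[mu]_z (F (x, z))%:E)%E.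
  apply: eq_integral => x _.
  rewrite (hQ _ (mshift _)) (gaussian_law_addl _ _ _ _ mB) addrC.
  rewrite /gaussian_law (negPf s20) /normal_prob integral_mkcond.
  rewrite -ge0_integralZr//=.
  - apply: eq_integral => z _; rewrite epatch_indic /= /F/= -!EFinM.
    by rewrite [X in X%:E]mulrAC mulrC mulrA.
  - apply/(measurable_restrictT _ _).1 => //; apply/measurable_EFinP.
    by apply: measurable_funTS; exact: measurable_normal_pdf.
  - by move=> z _; apply: erestrict_ge0 => y _; rewrite lee_fin normal_pdf_ge0.
  - by rewrite lee_fin normal_pdf_ge0.
transitivity (\int[mu]_z \int[mu]_x (F (x, z))%:E)%E.
  apply: (fubini_tonelli (m1 := mu) (m2 := mu) (fun xz => (F xz)%:E)) => //.
  by apply/measurable_EFinP.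
have v0 : Num.sqrt (s1 ^+ 2 + s2 ^+ 2) != 0.
  by rewrite gt_eqF// sqrtr_gt0 addr_gt0// exprn_even_gt0.
rewrite /gaussian_law (negPf v0) /normal_prob [RHS]integral_mkcond.
apply: eq_integral => z _; rewrite epatch_indic.
under eq_integral do rewrite /F/= normal_pdf_conv// mulrA EFinM.
rewrite ge0_integralZl//=.
- by rewrite integral_normal_pdf mule1 EFinM muleC.
- by apply/measurable_EFinP; exact: measurable_normal_pdf.
- by move=> x _; rewrite lee_fin normal_pdf_ge0.
- by rewrite lee_fin mulr_ge0 ?normal_pdf_ge0.
Qed.

End normal_laws.

(** * Laws of independent variables *)

Section joint_law.
Context d d1 d2 (Om : measurableType d) (T1 : measurableType d1)
  (T2 : measurableType d2) (R : realType) (P : probability Om R).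

(** If X, Y and the event E are independent, then on E the pair (X, Y) has the
product of the laws of X and Y as its law, up to the factor P(E). *)
Lemma joint_law (X : {RV P >-> T1}) (Y : {RV P >-> T2}) (E : set Om) :
  measurable E ->
  (forall A B, measurable A -> measurable B ->
    P (X @^-1` A `&` (Y @^-1` B `&` E)) =
    (P (X @^-1` A) * (P (Y @^-1` B) * P E))%E) ->
  forall D, measurable D ->
    P ((fun w => (X w, Y w)) @^-1` D `&` E) =
    (P E * (distribution P X \x distribution P Y) D)%E.
Proof.
move=> mE XYE D mD.
have mZ : measurable_fun setT (fun w => (X w, Y w)).
  by apply/measurable_fun_pairP; split; exact: measurable_funP.
pose Z : {mfun Om >-> (T1 * T2)%type} :=
  HB.pack (fun w => (X w, Y w)) (isMeasurableFun.Build _ _ _ _ _ mZ).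
have PE0 : 0 <= fine (P E) by rewrite fine_ge0.
pose r : {nonneg R} := NngNum PE0.
have rE : ((fine (P E))%:E = P E)%E by rewrite fineK// fin_num_measure.
(* the law of (X, Y) under the restriction of P to E has the values on
   rectangles of the product of the law of X and of P(E) times the law of Y *)
have H A B : measurable A -> measurable B ->
    pushforward (mrestr P mE) Z (A `*` B) =
    (distribution P X A * mscale r (distribution P Y) B)%E.
  move=> mA mB; rewrite /mscale /= rE /pushforward /mrestr.
  rewrite [X in P X](_ : _ = X @^-1` A `&` (Y @^-1` B `&` E)); last first.
    by rewrite setIA; apply/seteqP; split.
  by rewrite XYE// (muleC (P E)).
have {H} := @product_measure_unique _ _ T1 T2 R (distribution P X)
  (mscale r (distribution P Y)) (pushforward (mrestr P mE) Z) H D mD.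
move=> H; transitivity (pushforward (mrestr P mE) Z D); first by [].
rewrite -(H mZ).
rewrite /product_measure1/= /mscale/= rE ge0_integralZl//.
exact: measurable_fun_xsection.
Qed.

End joint_law.

Section gaussian_sums.
Context d (Om : measurableType d) (R : realType) (P : probability Om R).

(** If X, Y and the event E are independent and X and Y are normal, then X + Y
is normal and independent of E. *)
Lemma gaussian_law_add (X Y : {RV P >-> R}) (m1 s1 m2 s2 : R) (E : set Om) :
  (forall B : set R, measurable B -> P (X @^-1` B) = gaussian_law m1 s1 B) ->
  (forall B : set R, measurable B -> P (Y @^-1` B) = gaussian_law m2 s2 B) ->
  measurable E ->
  (forall A B : set R, measurable A -> measurable B ->
    P (X @^-1` A `&` (Y @^-1` B `&` E)) =
    (P (X @^-1` A) * (P (Y @^-1` B) * P E))%E) ->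
  forall B : set R, measurable B ->
    P ((X + Y) @^-1` B `&` E) =
    (gaussian_law (m1 + m2)%R (Num.sqrt (s1 ^+ 2 + s2 ^+ 2)%R) B * P E)%E.
Proof.
move=> hX hY mE hE B mB.
(* [measurableTypeR R], on which the Lebesgue measure is defined, has the same
   measurable sets as R under another display; X' and Y' are X and Y with this
   codomain *)
have mV (V : {RV P >-> R}) : measurable_fun (U := measurableTypeR R) setT V.
  by move=> mT A mA; exact: (measurable_funP V mT (A : set R)).
pose X' : {mfun Om >-> measurableTypeR R} :=
  HB.pack (X : Om -> measurableTypeR R)
    (isMeasurableFun.Build _ _ _ _ _ (mV X)).
pose Y' : {mfun Om >-> measurableTypeR R} :=
  HB.pack (Y : Om -> measurableTypeR R)
    (isMeasurableFun.Build _ _ _ _ _ (mV Y)).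
have := @joint_law _ _ _ _ _ _ R P X' Y' E mE hE _
  (measurable_preimage_add _ mB).
rewrite muleC => H; apply: etrans H _; congr (_ * _)%E.
rewrite -(@gaussian_law_conv _ m1 s1 m2 s2
  (distribution P X') (distribution P Y') hX hY B mB).
rewrite /product_measure1; apply: eq_integral => x _ /=.
congr (distribution P _ _).
by apply/seteqP; split => y; rewrite /xsection/= inE.
Qed.

(** Mutual independence of a finite family of real random variables: the product
rule over every subfamily. *)
Definition mutually_independent (K : finType) (Y : K -> {RV P >-> R}) : Prop :=
  forall (L : {set K}) (B : K -> set R), (forall k, measurable (B k)) ->
    P (\bigcap_(k in [set` L]) (Y k @^-1` B k)) =
    (\prod_(k in L) P (Y k @^-1` B k))%E.

(** A finite sum of independent normal variables is normal. *)
Lemma gaussian_sum (K : finType) (Y : K -> {RV P >-> R}) :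
  mutually_independent K Y ->
  (forall k, gaussian P (Y k)) -> gaussian P (\sum_k Y k).
Proof.
move=> hind hY.
pose cyl (M : {set K}) (C : K -> set R) :=
  \bigcap_(k in [set` M]) (Y k @^-1` C k).
have mcyl M C : (forall k, measurable (C k)) -> measurable (cyl M C).
  move=> mC; apply: fin_bigcap_measurable => // k _.
  exact: measurable_funPTI.
have cyl0 C : cyl finset.set0 C = setT.
  by apply/seteqP; split=> // w _ k /=; rewrite inE.
(* the induction hypothesis also says that the partial sum over s is independent
   of the events determined by the variables with indices outside s *)
suff H (s : seq K) : uniq s -> exists m v : R,
    forall (M : {set K}) (C : K -> set R) (B : set R),
    (forall k, measurable (C k)) -> measurable B ->
    {in s, forall k, k \notin M} ->
    P ((\sum_(k <- s) Y k) @^-1` B `&` cyl M C) =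
    (gaussian_law m v B * P (cyl M C))%E.
  have [m [v h]] := H _ (index_enum_uniq K).
  exists m, v => B mB.
  have := h finset.set0 (fun=> setT) B (fun=> measurableT) mB.
  by rewrite cyl0 setIT probability_setT mule1; apply => k _; rewrite inE.
elim: s => [_|a s IH /= /andP[as_ /IH[m [v {}IH]]]].
  (* the empty sum has the degenerate law N(0, 0) *)
  exists 0, 0 => M C B mC mB _; rewrite big_nil /gaussian_law eqxx diracE.
  have [B0|B0] := boolP (0 \in B); rewrite ?mulr1n ?mulr0n ?mul1e ?mul0e.
    rewrite [X in P X = _](_ : _ = cyl M C)//.
    apply/seteqP; split=> [w []//|w Mw]; split => //=; exact: set_mem.
  rewrite [X in P X = _](_ : _ = set0) ?measure0//.
  apply/seteqP; split=> [w [/= w0 _]|//].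
  by move/negP: B0; apply; apply/mem_set.
have [m1 [s1 hYa]] := hY a.
have hS A : measurable A ->
    P ((\sum_(k <- s) Y k) @^-1` A) = gaussian_law m v A.
  move=> mA; have := IH finset.set0 (fun=> setT) A (fun=> measurableT) mA.
  by rewrite cyl0 setIT probability_setT mule1; apply => k _; rewrite inE.
exists (m1 + m), (Num.sqrt (s1 ^+ 2 + v ^+ 2)) => M C B mC mB dis.
have aM : a \notin M by apply: dis; rewrite mem_head.
rewrite big_cons; apply: gaussian_law_add => //; first exact: mcyl.
move=> A A' mA mA'.
(* the event that Y a lies in A is absorbed into the cylinder over M *)
pose C' k := if k == a then A else C k.
have mC' k : measurable (C' k) by rewrite /C'; case: ifP.
have C'M k : k \in M -> C' k = C k.
  by move=> kM; rewrite /C'; case: eqP => // ka; rewrite -ka kM in aM.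
have cylU : cyl (a |: M)%SET C' = Y a @^-1` A `&` cyl M C.
  apply/seteqP; split=> [w h|w [wA h] k /=].
    split; first by have := h a; rewrite /= !inE eqxx /C' eqxx; apply.
    by move=> k /= kM; have := h k; rewrite /= !inE kM orbT C'M//; apply.
  rewrite !inE => /orP[/eqP ->|kM]; first by rewrite /C' eqxx.
  by rewrite C'M//; exact: h.
rewrite setICA -cylU IH//; last first.
  move=> k ks; rewrite !inE negb_or dis ?andbT; last by rewrite inE ks orbT.
  by apply: contraNneq as_ => <-.
rewrite (hind (a |: M)%SET C' mC') big_setU1//= hS// muleCA /C' eqxx.
congr (_ * (_ * _))%E; rewrite hind//.
by apply: eq_bigr => k kM; congr (P (_ @^-1` _)); exact: C'M.
Qed.

End gaussian_sums.

Arguments mutually_independent {d Om R} P {K} Y.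

(** * Expectations *)

Section expectation.
Context d (Om : measurableType d) (R : realType) (P : probability Om R).

Lemma expectation_sum_fin (I : finType) (X : I -> Om -> R) :
  (forall i, X i \in Lfun P 1) ->
  ('E_P[fun w => (\sum_i X i w)%R] = \sum_i 'E_P[X i])%E.
Proof.
move=> XL; rewrite -fct_sumE -(big_map X predT id) expectation_sum.
  by rewrite big_map.
by move=> _ /mapP[i _ ->].
Qed.

Lemma Lfun2_expectation_sqr (X : {RV P >-> R}) :
  ('E_P[X \* X] < +oo)%E -> (X : Om -> R) \in Lfun P 2%:E.
Proof.
move=> XX; rewrite inE; apply/andP; split; rewrite inE/=.
  exact: measurable_funP.
rewrite /finite_norm unlock; apply: poweR_lty.
apply: le_lt_trans XX; rewrite unlock le_eqVlt; apply/orP; left; apply/eqP.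
apply: eq_integral => w _.
by rewrite /= powR_mulrn// real_normK ?num_real// expr2.
Qed.

Lemma expectation_mul (X Y : {RV P >-> R}) :
  (X : Om -> R) \in Lfun P 1 -> (Y : Om -> R) \in Lfun P 1 ->
  X \* Y \in Lfun P 1 ->
  (forall A B : set R, measurable A -> measurable B ->
    P (X @^-1` A `&` Y @^-1` B) = (P (X @^-1` A) * P (Y @^-1` B))%E) ->
  ('E_P[X \* Y] = 'E_P[X] * 'E_P[Y])%E.
Proof.
move=> X1 Y1 XY1 ind.
have mZ : measurable_fun setT (fun w => (X w, Y w)).
  by apply/measurable_fun_pairP; split; exact: measurable_funP.
pose Z : {mfun Om >-> (R * R)%type} :=
  HB.pack (fun w => (X w, Y w)) (isMeasurableFun.Build _ _ _ _ _ mZ).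
pose f (z : R * R) := (z.1 * z.2)%:E.
have mf : measurable_fun setT f.
  by apply/measurable_EFinP; exact: measurable_funM.
have intf : P.-integrable setT (f \o Z) by exact/Lfun1_integrable.
have ZE D : measurable D ->
    pushforward P Z D = (distribution P X \x distribution P Y)%E D.
  move=> mD; have := @joint_law _ _ _ _ _ _ R P X Y setT measurableT _ D mD.
  rewrite setIT probability_setT mul1e; apply => A B mA mB.
  by rewrite setIT mule1 ind.
have intfZ : (pushforward P Z).-integrable setT f.
  exact: integrable_pushforward.
have intfXY : (distribution P X \x distribution P Y)%E.-integrable setT f.
  apply/integrableP; split=> //.
  rewrite (eq_measure_integral (pushforward P Z)).
    by case/integrableP : intfZ.
  by move=> D mD _; exact/esym/ZE.
have intid (V : {RV P >-> R}) : (V : Om -> R) \in Lfun P 1 ->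
    (distribution P V).-integrable setT EFin.
  by move=> V1; apply: integrable_pushforward => //; exact/Lfun1_integrable.
have EV (V : {RV P >-> R}) : (V : Om -> R) \in Lfun P 1 ->
    (\int[distribution P V]_x x%:E = 'E_P[V])%E.
  by move=> V1; rewrite unlock integral_distribution//; exact/Lfun1_integrable.
transitivity (\int[pushforward P Z]_z f z)%E.
  by rewrite unlock integral_pushforward.
rewrite (eq_measure_integral (distribution P X \x distribution P Y)%E);
  last first.
  by move=> D mD _; exact: ZE.
rewrite -integral12_prod_meas1// /fubini_F.
under eq_integral => x _.
  under eq_integral do rewrite /f/= EFinM.
  rewrite integralZl//; last exact: intid.
  rewrite EV//.
  over.
have /fineK <- : 'E_P[Y]%E \is a fin_num by exact: expectation_fin_num.
by rewrite integralZr ?EV//; exact: intid.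
Qed.

End expectation.

(** * Independent processes *)

Section processes.
Context d (Om : measurableType d) (R : realType) (P : probability Om R).

Lemma process_sigma_algebra_linear (I : Type) (X : I -> {RV P >-> R})
    (n : nat) (t : 'I_n -> I) (a : 'I_n -> R) (B : set R) : measurable B ->
  process_sigma_algebra P X ((\sum_(i < n) a i *: X (t i)) @^-1` B).
Proof.
move=> mB; pose G := \bigcup_(t in [set: I]) g_sigma_algebra_preimage (X t).
have mX s : measurable_fun (setT : set (g_sigma_algebraType G)) (X s).
  move=> _ C mC; rewrite setTI; apply: sub_sigma_algebra; exists s => //.
  by exists C => //; rewrite setTI.
have mS : measurable_fun (setT : set (g_sigma_algebraType G))
    (fun w => \sum_(i < n) a i * X (t i) w).
  by apply: measurable_sum => i; exact: measurable_funM.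
have := mS measurableT B mB; rewrite setTI.
rewrite [X in measurable X -> _](_ : _ =
  (\sum_(i < n) a i *: X (t i)) @^-1` B)//.
by apply/seteqP; split => w /=; rewrite mfun_sum.
Qed.

Lemma independent_processes_linear (K : finType) (I : K -> Type)
    (X : forall k, I k -> {RV P >-> R}) (Y : K -> {RV P >-> R}) :
  independent_processes P X ->
  (forall k, exists n (t : 'I_n -> I k) (a : 'I_n -> R),
    Y k = \sum_(i < n) a i *: X k (t i)) ->
  mutually_independent P Y.
Proof.
move=> hX hY L B mB; apply: (hX L) => k _.
by have [n [t [a ->]]] := hY k; exact: process_sigma_algebra_linear.
Qed.

Lemma independent_processes_pair (K : finType) (I : K -> Type)
    (X : forall k, I k -> {RV P >-> R}) (k l : K) (s : I k) (t : I l) :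
  independent_processes P X -> k != l ->
  forall A B : set R, measurable A -> measurable B ->
    P (X k s @^-1` A `&` X l t @^-1` B) =
    (P (X k s @^-1` A) * P (X l t @^-1` B))%E.
Proof.
move=> hX kl A B mA mB.
pose C i := if i == k then X k s @^-1` A else X l t @^-1` B.
have psa i (u : I i) D : measurable D ->
    process_sigma_algebra P (X i) (X i u @^-1` D).
  move=> mD; apply: sub_sigma_algebra; exists u => //; exists D => //.
  by rewrite setTI.
have lk : (l == k) = false by rewrite eq_sym (negPf kl).
have := hX [set k; l]%SET C.
rewrite big_setU1 ?inE//= big_set1 /C eqxx lk => <-; last first.
  by move=> i; rewrite !inE => /orP[]/eqP ->; rewrite ?eqxx ?lk; exact: psa.
congr (P _); apply/seteqP; split => [w [wA wB] i /=|w h].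
  by case: ifP.
split; first by have := h k; rewrite /= !inE eqxx; apply.
by have := h l; rewrite /= !inE eqxx orbT lk; apply.
Qed.

End processes.

(** * The Brownian sheet *)

(** The expansion of prod_j ((min(x_j, y_j) - x_j y_j) + x_j y_j); the set H
collects the factors in which the first term is chosen. *)
Lemma prod_min_split (R : realDomainType) (p : nat) (x y : 'I_p -> R) :
  \prod_(j < p) Num.min (x j) (y j) =
  \sum_(H : {set 'I_p}) (\prod_(j in ~: H) x j) * (\prod_(j in ~: H) y j) *
     \prod_(j in H) (Num.min (x j) (y j) - x j * y j).
Proof.
transitivity (\prod_(j < p) ((Num.min (x j) (y j) - x j * y j) + x j * y j)).
  by apply: eq_bigr => j _; rewrite subrK.
rewrite bigA_distr; apply: eq_big => [H|H _]; first by rewrite inE.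
rewrite (bigID (mem H)) mulrC -big_split/=; congr (_ * _).
  by apply: eq_bigr => j ->.
by apply: eq_big => j; [rewrite inE|move=> jH; rewrite ifN].
Qed.

Theorem theorem2 (R : realType) (d : measure_display) (Om : measurableType d)
    (P : probability Om R) (p : nat) (hp : (1 <= p)%N)
    (T : forall H : {set 'I_p}, face R H -> {RV P >-> R})
    (hT : forall H : {set 'I_p}, brownian_tent P (T H))
    (hindep : independent_processes P T) :
  brownian_sheet P (fun t : cube R p => \sum_(H : {set 'I_p}) ramp (T H) t).
Proof.
have T2 H t : (T H t : Om -> R) \in Lfun P 2%:E.
  by apply: Lfun2_expectation_sqr; have [_ _ ->] := hT H; rewrite ltry.
have T1 H t : (T H t : Om -> R) \in Lfun P 1.
  by apply: Lfun_subset12 => //; exact: fin_num_measure.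
pose c (H : {set 'I_p}) (t : cube R p) : R := \prod_(j in ~: H) \val t 0 j.
have TT1 H s K t : T H s \* T K t \in Lfun P 1 by exact: Lfun2_mul_Lfun1.
split.
- move=> n t a.
  pose Y H := \sum_(i < n) (a i * c H (t i)) *: T H (to_face H (t i)).
  rewrite (_ : \sum_(i < n) _ = \sum_(H : {set 'I_p}) Y H); last first.
    rewrite exchange_big; apply: eq_bigr => i _; rewrite scaler_sumr.
    by apply: eq_bigr => H _; rewrite /ramp scalerA.
  apply: gaussian_sum.
    apply: (@independent_processes_linear _ _ _ P _ _ T Y hindep) => H.
    by exists n, (fun i => to_face H (t i)), (fun i => a i * c H (t i)).
  by move=> H; have [gT _ _] := hT H; exact: gT.
- move=> t.
  rewrite (_ : (\sum_H ramp (T H) t : Om -> R) = fun w =>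
      \sum_H (c H t \o* T H (to_face H t)) w); last first.
    apply/funext => w; rewrite mfun_sum.
    by apply: eq_bigr => H _ /=; rewrite mulrC.
  rewrite expectation_sum_fin; last by move=> H; apply: Lfun_scale.
  apply: big1 => H _; rewrite expectationZl//.
  by have [_ -> _] := hT H; rewrite mule0.
- move=> s t.
  rewrite (_ : _ \* _ = fun w => \sum_(HK : {set 'I_p} * {set 'I_p})
      ((c HK.1 s * c HK.2 t) \o*
       (T HK.1 (to_face HK.1 s) \* T HK.2 (to_face HK.2 t))) w); last first.
    apply/funext => w /=; rewrite !mfun_sum mulr_suml.
    rewrite -(pair_bigA _ (fun H K =>
      T H (to_face H s) w * T K (to_face K t) w * (c H s * c K t)))/=.
    apply: eq_bigr => H _; rewrite mulr_sumr; apply: eq_bigr => K _ /=.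
    by rewrite mulrACA mulrC.
  rewrite expectation_sum_fin; last by move=> HK; apply: Lfun_scale.
  under eq_bigr do rewrite expectationZl//.
  rewrite -(pair_bigA _ (fun H K => (c H s * c K t)%:E *
    'E_P[T H (to_face H s) \* T K (to_face K t)])%E)/=.
  rewrite prod_min_split -sumEFin; apply: eq_bigr => H _.
  (* only the pairs with equal indices contribute *)
  rewrite (bigD1 H)//= big1 ?adde0; last first.
    move=> K KH; rewrite expectation_mul//.
      by have [_ -> _] := hT H; rewrite mul0e mule0.
    apply: (@independent_processes_pair _ _ _ P _ _ T _ _ _ _ hindep).
    by rewrite eq_sym.
  have [_ _ ->] := hT H; rewrite -EFinM; congr (_ * _)%:E.
  (* projecting to the face of H keeps the coordinates in H *)
  by apply: eq_bigr => j jH; rewrite /= !mxE jH.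
Qed.
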